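(* The triple $\mathbb M^\bullet_\cup=(M_\cup,\eta,\mu^\bullet)$ is a monad on the category of compacta and continuous maps. In particular, for every compactum $X$: (i) $\mu^\bullet X\circ\eta(M_\cup X)=\mu^\bullet X\circ M_\cup(\eta X)=\mathrm{id}_{M_\cup X}$; (ii) $\mu^\bullet X\circ\mu^\bullet(M_\cup X)=\mu^\bullet X\circ M_\cup(\mu^\bullet X)$ as maps $M_\cup(M_\cup(M_\cup X))\to M_\cup X$.
   Context: A compactum is a compact Hausdorff space; $I=[0,1]$; $\mathcal F(X)$ denotes the family of closed subsets of $X$. An (upper-semicontinuous) capacity on a compactum $X$ is a function $\nu:\mathcal F(X)\to I$ such that: (1) $\nu(X)=1$, $\nu(\emptyset)=0$; (2) if $F\subset G$ then $\nu(F)\le\nu(G)$; (3) if $\nu(F)<a$ then there is an open set $O\supset F$ with $\nu(B)<a$ for every closed $B\subset O$. $MX$ is the set of all capacities on $X$, topologized by the subbase consisting of the sets $\{c\in MX: c(F)<a\}$ ($F$ closed, $a\in I$) and $\{c\in MX: c(U)>a\}$ ($U$ open, $a\in I$), where $c(U)=\sup\{c(K):K\text{ closed},K\subset U\}$; it is a compactum. A capacity $\nu$ is a possibility capacity if $\nu(A\cup B)=\max\{\nu(A),\nu(B)\}$ for all closed $A,B$; $M_\cup X$ denotes the (closed) subspace of $MX$ of possibility capacities. For a continuous map $f:X\to Y$, $M_\cup f:M_\cup X\to M_\cup Y$ is $M_\cup f(c)(F)=c(f^{-1}(F))$; this makes $M_\cup$ an endofunctor of the category of compacta. $\eta X:X\to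 M_\cup X$ is $\eta X(x)(F)=1$ if $x\in F$ and $0$ otherwise. For a closed $F\subset X$ and $t\in I$ put $F_t=\{c\in M_\cup X: c(F)\ge t\}$, a closed subset of $M_\cup X$. The map $\mu^\bullet X: M_\cup(M_\cup X)\to M_\cup X$ is $\mu^\bullet X(\mathcal C)(F)=\max\{\mathcal C(F_t)\cdot t: t\in(0,1]\}$ (the maximum exists and the result is a possibility capacity). A monad $(T,\eta,\mu)$ on a category consists of an endofunctor $T$ and natural transformations $\eta:\mathrm{Id}\to T$, $\mu:T^2\to T$ with $\mu\circ T\eta=\mu\circ\eta T=1_T$ and $\mu\circ\mu T=\mu\circ T\mu$. *)

(* Defs.v *)
From Stdlib Require Import Reals List Classical ClassicalEpsilon
  FunctionalExtensionality PropExtensionality.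
Open Scope R_scope.

(* A topological space is encoded as a carrier type [car], a distinguished
   subset [pts] of points (the space itself) and a family [opn] of open sets
   (each contained in [pts]).  This lets the iterated constructions
   M_cup X, M_cup (M_cup X), ... live on plain function types. *)
Record Space := mkSpace {
  car : Type;
  pts : car -> Prop;
  opn : (car -> Prop) -> Prop }.

Definition subset {T : Type} (A B : T -> Prop) : Prop := forall x, A x -> B x.

Definition is_topology {T : Type} (P : T -> Prop) (op : (T -> Prop) -> Prop) : Prop :=
  (forall U, op U -> subset U P) /\
  op P /\ op (fun _ => False) /\
  (forall U V, op U -> op V -> op (fun x => U x /\ V x)) /\
  (forall Fam : (T -> Prop) -> Prop,
      (forall U, Fam U -> op U) -> op (fun x => exists U, Fam U /\ U x)).

Definition is_closed (X : Space) (A : car X -> Prop) : Prop :=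
  subset A (pts X) /\ opn X (fun x => pts X x /\ ~ A x).

Definition compact (X : Space) : Prop :=
  forall Fam : (car X -> Prop) -> Prop,
    (forall U, Fam U -> opn X U) ->
    (forall x, pts X x -> exists U, Fam U /\ U x) ->
    exists l : list (car X -> Prop),
      (forall U, In U l -> Fam U) /\ (forall x, pts X x -> exists U, In U l /\ U x).

Definition hausdorff (X : Space) : Prop :=
  forall x y, pts X x -> pts X y -> x <> y ->
    exists U V, opn X U /\ opn X V /\ U x /\ V y /\ (forall z, U z -> V z -> False).

Definition compactum (X : Space) : Prop :=
  is_topology (pts X) (opn X) /\ compact X /\ hausdorff X.

Definition continuous (X Y : Space) (f : car X -> car Y) : Prop :=
  (forall x, pts X x -> pts Y (f x)) /\
  (forall V, opn Y V -> opn X (fun x => pts X x /\ V (f x))).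

(* A capacity is a function on F(X); it is encoded as a function on all
   subsets which is normalised to 0 outside F(X), so that capacities are
   determined by their values on closed sets (Leibniz equality = equality
   as functions F(X) -> I). *)
Definition capacity (X : Space) (c : (car X -> Prop) -> R) : Prop :=
  (forall A, ~ is_closed X A -> c A = 0) /\
  (forall A, is_closed X A -> 0 <= c A <= 1) /\
  c (pts X) = 1 /\ c (fun _ => False) = 0 /\
  (forall A B, is_closed X A -> is_closed X B -> subset A B -> c A <= c B) /\
  (forall F a, is_closed X F -> c F < a ->
     exists O, opn X O /\ subset F O /\
       (forall B, is_closed X B -> subset B O -> c B < a)).

Definition poss_capacity (X : Space) (c : (car X -> Prop) -> R) : Prop :=
  capacity X c /\
  (forall A B, is_closed X A -> is_closed X B ->
     c (fun x => A x \/ B x) = Rmax (c A) (c B)).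

Definition generated {T : Type} (P : T -> Prop) (S : (T -> Prop) -> Prop)
  (U : T -> Prop) : Prop :=
  forall op, is_topology P op -> (forall V, S V -> op V) -> op U.

(* subbase of M_cup X (restriction of the subbase of MX):
   {c : c(F) < a}, F closed, and {c : c(U) > a}, U open, where
   c(U) = sup{c(K) : K closed, K ⊆ U}, so c(U) > a iff some such K has c(K) > a. *)
Definition MU_subbase (X : Space) (V : ((car X -> Prop) -> R) -> Prop) : Prop :=
  (exists F a, is_closed X F /\ 0 <= a <= 1 /\
     V = (fun c => poss_capacity X c /\ c F < a)) \/
  (exists U a, opn X U /\ 0 <= a <= 1 /\
     V = (fun c => poss_capacity X c /\
            exists K, is_closed X K /\ subset K U /\ a < c K)).

Definition MU (X : Space) : Space :=
  mkSpace ((car X -> Prop) -> R) (poss_capacity X)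
          (generated (poss_capacity X) (MU_subbase X)).

Definition etaR (X : Space) (x : car X) : car (MU X) :=
  fun A => if excluded_middle_informative (is_closed X A /\ A x) then 1 else 0.

Definition MR (X Y : Space) (f : car X -> car Y) (c : car (MU X)) : car (MU Y) :=
  fun B => if excluded_middle_informative (is_closed Y B)
           then c (fun x => pts X x /\ B (f x)) else 0.

Definition level_set (X : Space) (F : car X -> Prop) (t : R) : car (MU X) -> Prop :=
  fun c => poss_capacity X c /\ t <= c F.

Definition is_mu_value (X : Space) (C : car (MU (MU X))) (F : car X -> Prop) (v : R) : Prop :=
  (exists t, 0 < t <= 1 /\ v = C (level_set X F t) * t) /\
  (forall t, 0 < t <= 1 -> C (level_set X F t) * t <= v).

Definition muR (X : Space) (C : car (MU (MU X))) : car (MU X) :=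
  fun F => if excluded_middle_informative (is_closed X F)
           then epsilon (inhabits 0) (is_mu_value X C F) else 0.

(* Main.v *)
Require Import Defs.
From Stdlib Require Import Reals List Classical ClassicalEpsilon
  FunctionalExtensionality PropExtensionality.
From Stdlib Require Import Lra.
From mathcomp Require classical_sets.
Open Scope R_scope.

(* A possibility capacity on a compactum is determined by its upper semicontinuous
   density x |-> c {x}, since c F = max {c {x} : x in F} for F nonempty.  In these
   terms mu^bullet C F = max {C {c} * c F : c in M_cup X}, and every monad identity
   reduces to exchanging two maxima.  The maxima exist because M_cup X is again a
   compactum, and its compactness follows from Alexander's subbase theorem.
   Compactness is used throughout as an induction principle: a property of subsets
   that passes to subsets and finite unions and holds locally holds globally. *)

(** Multiplication by a nonnegative number is monotone, so it passes through a maximum; this is why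
    iterated products can be regrouped under a double maximum. Two obstacles shape the details. A
    positive value of a capacity is attained at a point, whereas the value 0 may come from the empty
    set; lemmas producing a point therefore ask for positivity, and the identities treat zero
    weights separately. Moreover, openness statements need bounds that are uniform over all [c] in
    [M_cup X]. Such bounds pass to nearby points and nearby capacities through a closed set [K]
    squeezed around an open neighbourhood, because [c K < a] is an open condition on [c] and
    controls every point of [K]. *)

Lemma set_ext {T : Type} (A B : T -> Prop) : (forall x, A x <-> B x) -> A = B.
Proof.
  intros H. apply functional_extensionality. intros x.
  apply propositional_extensionality, H.
Qed.

(** * Open and closed sets of an encoded space *)

Lemma open_empty (X : Space) :
  is_topology (pts X) (opn X) -> opn X (fun _ => False).
Proof. intros (_ & _ & H & _). exact H. Qed.

Lemma open_pts (X : Space) : is_topology (pts X) (opn X) -> opn X (pts X).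
Proof. intros (_ & H & _). exact H. Qed.

Lemma open_inter (X : Space) (U V : car X -> Prop) :
  is_topology (pts X) (opn X) -> opn X U -> opn X V ->
  opn X (fun x => U x /\ V x).
Proof. intros (_ & _ & _ & H & _). apply H. Qed.

Lemma open_ext (X : Space) (U V : car X -> Prop) :
  (forall x, U x <-> V x) -> opn X U -> opn X V.
Proof. intros H. now rewrite (set_ext U V H). Qed.

Lemma open_nbhd (X : Space) (U : car X -> Prop) :
  is_topology (pts X) (opn X) ->
  (forall x, U x -> exists V, opn X V /\ V x /\ subset V U) -> opn X U.
Proof.
  intros (_ & _ & _ & _ & Hun) H.
  apply (open_ext X (fun x => exists V, (opn X V /\ subset V U) /\ V x)).
  - intros x. split.
    + intros (V & (_ & VU) & Vx). auto.
    + intros Hx. destruct (H x Hx) as (V & HV & Vx & VU). exists V. tauto.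
  - apply Hun. tauto.
Qed.

Lemma open_union (X : Space) (U V : car X -> Prop) :
  is_topology (pts X) (opn X) -> opn X U -> opn X V ->
  opn X (fun x => U x \/ V x).
Proof.
  intros HT HU HV. apply open_nbhd; auto.
  intros x [Hx | Hx]; [exists U | exists V]; repeat split; auto; intros y; tauto.
Qed.

Lemma closed_compl (X : Space) (U : car X -> Prop) :
  is_topology (pts X) (opn X) -> opn X U ->
  is_closed X (fun x => pts X x /\ ~ U x).
Proof.
  intros HT HU. split; [intros x; tauto |].
  apply (open_ext X U); auto.
  intros x. split; [intros Hx | intros [Hx H]; tauto].
  assert (pts X x) by (apply (proj1 HT U HU); auto). tauto.
Qed.

Lemma closed_empty (X : Space) :
  is_topology (pts X) (opn X) -> is_closed X (fun _ => False).
Proof.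
  intros HT. split; [intros x; tauto |].
  apply (open_ext X (pts X)); [intros x; tauto | now apply open_pts].
Qed.

Lemma closed_pts (X : Space) :
  is_topology (pts X) (opn X) -> is_closed X (pts X).
Proof.
  intros HT. split; [intros x; tauto |].
  apply (open_ext X (fun _ => False)); [intros x; tauto | now apply open_empty].
Qed.

Lemma closed_union (X : Space) (A B : car X -> Prop) :
  is_topology (pts X) (opn X) -> is_closed X A -> is_closed X B ->
  is_closed X (fun x => A x \/ B x).
Proof.
  intros HT [A1 A2] [B1 B2]. split; [intros x [H | H]; auto |].
  apply (open_ext X (fun x => (pts X x /\ ~ A x) /\ (pts X x /\ ~ B x)));
    [intros x; tauto | apply open_inter; auto].
Qed.

Lemma closed_preimage (X Y : Space) (f : car X -> car Y) (F : car Y -> Prop) :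
  continuous X Y f -> is_closed Y F -> is_closed X (fun x => pts X x /\ F (f x)).
Proof.
  intros [Hf1 Hf2] [F1 F2]. split; [intros x; tauto |].
  apply (open_ext X (fun x => pts X x /\ (pts Y (f x) /\ ~ F (f x)))).
  - intros x. specialize (Hf1 x). tauto.
  - apply (Hf2 _ F2).
Qed.

(** * Compactness as induction, regularity and normality *)

(** The cover consists of the open [U] whose trace on [F] satisfies [P]. Points of [F] have such a
    neighbourhood by hypothesis, and the complement of [F] qualifies because its trace is empty. A
    finite subcover gives [P F] by induction on the list. *)
Lemma compact_induct (X : Space) (P : (car X -> Prop) -> Prop) (F : car X -> Prop) :
  Defs.compact X ->
  (forall A B, subset A B -> P B -> P A) ->
  P (fun _ => False) ->
  (forall A B, P A -> P B -> P (fun x => A x \/ B x)) ->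
  is_closed X F ->
  (forall x, F x -> exists U, opn X U /\ U x /\ P U) ->
  P F.
Proof.
  intros HC Hsub H0 Hun [F1 F2] Hloc.
  destruct (HC (fun U => opn X U /\ P (fun x => U x /\ F x))) as (l & Hl & Hcov).
  - tauto.
  - intros x Hx. destruct (classic (F x)) as [Fx | Fx].
    + destruct (Hloc x Fx) as (U & HU & Ux & PU).
      exists U. repeat split; auto. apply (Hsub _ U); auto. intros y; tauto.
    + exists (fun x => pts X x /\ ~ F x). repeat split; auto.
      apply (Hsub _ (fun _ => False)); auto. intros y; tauto.
  - assert (HP : P (fun x => (exists U, In U l /\ U x) /\ F x)).
    { clear Hcov. induction l as [| U l IH].
      - apply (Hsub _ (fun _ => False)); auto. intros x [(U & [] & _) _].
      - apply (Hsub _ (fun x => (U x /\ F x) \/ ((exists V, In V l /\ V x) /\ F x))).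
        + intros x [(V & [-> | HV] & Vx) Fx]; [left; auto | right]. split; eauto.
        + apply Hun; [apply Hl; simpl; auto | apply IH].
          intros V HV. apply Hl. simpl. auto. }
    apply (Hsub _ _) with (2 := HP). intros x Fx. split; auto.
Qed.

Definition sing {T : Type} (x : T) : T -> Prop := fun y => y = x.

Lemma closed_sing (X : Space) (x : car X) :
  compactum X -> pts X x -> is_closed X (sing x).
Proof.
  intros (HT & _ & HH) Hx. split; [intros y ->; auto |].
  apply open_nbhd; auto. intros y [Hy Hne].
  destruct (HH x y) as (U & V & HU & HV & Ux & Vy & D); auto.
  exists V. repeat split; auto.
  - apply (proj1 HT V); auto.
  - intros E. unfold sing in E. subst x0. eauto.
Qed.

(** Induction over [F] with [x] fixed: for a union, the neighbourhoods of [x] are intersected and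
    those of the pieces united. *)
Lemma regular_separation (X : Space) (x : car X) (F : car X -> Prop) :
  compactum X -> pts X x -> is_closed X F -> ~ F x ->
  exists U V, opn X U /\ opn X V /\ U x /\ subset F V /\ (forall z, U z -> V z -> False).
Proof.
  intros (HT & HC & HH) Hx HF Fx.
  apply (compact_induct X (fun A => exists U V,
    opn X U /\ opn X V /\ U x /\ subset A V /\ (forall z, U z -> V z -> False)) F);
    auto.
  - intros A B AB (U & V & H1 & H2 & H3 & H4 & H5).
    exists U, V. repeat split; auto. intros y Hy; auto.
  - exists (pts X), (fun _ => False). repeat split; auto using open_pts, open_empty. intros y; tauto.
  - intros A B (U & V & H1 & H2 & H3 & H4 & H5) (U' & V' & H1' & H2' & H3' & H4' & H5').
    exists (fun y => U y /\ U' y), (fun y => V y \/ V' y). repeat split; auto.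
    + apply open_inter; auto.
    + apply open_union; auto.
    + intros y [Hy | Hy]; auto.
    + intros z [] []; eauto.
  - intros y Fy. destruct (HH x y) as (U & V & HU & HV & Ux & Vy & D); auto.
    + apply (proj1 HF); auto.
    + intros ->. auto.
    + exists V. repeat split; auto. exists U, V. repeat split; auto. intros z; auto.
Qed.

(** [K] is the complement of an open set that contains the complement of [O] and misses [V]. The
    separation is an induction over [F], with regularity at each point. *)
Lemma normal_shrink (X : Space) (F O : car X -> Prop) :
  compactum X -> is_closed X F -> opn X O -> subset F O ->
  exists V K, opn X V /\ is_closed X K /\ subset F V /\ subset V K /\ subset K O.
Proof.
  intros HX HF HO FO. pose proof HX as (HT & HC & HH).
  assert (H : exists U V, opn X U /\ opn X V /\ subset (fun x => pts X x /\ ~ O x) U /\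
            subset F V /\ (forall z, U z -> V z -> False)).
  { apply (compact_induct X (fun A => exists U V, opn X U /\ opn X V /\
      subset (fun x => pts X x /\ ~ O x) U /\ subset A V /\
      (forall z, U z -> V z -> False)) F); auto.
    - intros A B AB (U & V & H1 & H2 & H3 & H4 & H5).
      exists U, V. repeat split; auto. intros y Hy; auto.
    - exists (pts X), (fun _ => False).
      repeat split; auto using open_pts, open_empty; intros y; tauto.
    - intros A B (U & V & H1 & H2 & H3 & H4 & H5)
        (U' & V' & H1' & H2' & H3' & H4' & H5').
      exists (fun y => U y /\ U' y), (fun y => V y \/ V' y). repeat split; auto.
      + apply open_inter; auto.
      + apply open_union; auto.
      + intros y [Hy | Hy]; auto.
      + intros z [] []; eauto.
    - intros y Fy.
      destruct (regular_separation X y (fun x => pts X x /\ ~ O x))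
        as (U & V & HU & HV & Uy & Vs & D); auto.
      + apply (proj1 HF); auto.
      + apply closed_compl; auto.
      + intros [_ H]. apply H, FO, Fy.
      + exists U. repeat split; auto. exists V, U.
        repeat split; auto; intros z; eauto. }
  destruct H as (U & V & HU & HV & OU & FV & D).
  exists V, (fun x => pts X x /\ ~ U x). repeat split; auto.
  - intros x; tauto.
  - apply closed_compl; auto.
  - apply (proj1 HT V); auto.
  - intros Hx; eauto.
  - intros x [Px Ux]. apply NNPP. intros Ox. apply Ux, OU. auto.
Qed.

(** * Possibility capacities and their values at points *)

Lemma capacity_nonneg (X : Space) c (A : car X -> Prop) : poss_capacity X c -> 0 <= c A.
Proof.
  intros [(H0 & H1 & _) _]. destruct (classic (is_closed X A)) as [HA | HA].
  - apply H1, HA.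
  - rewrite H0; auto. lra.
Qed.

Lemma capacity_le_1 (X : Space) c (A : car X -> Prop) : poss_capacity X c -> c A <= 1.
Proof.
  intros [(H0 & H1 & _) _]. destruct (classic (is_closed X A)) as [HA | HA].
  - apply H1, HA.
  - rewrite H0; auto. lra.
Qed.

Lemma capacity_mono (X : Space) c (A B : car X -> Prop) :
  poss_capacity X c -> is_closed X A -> is_closed X B -> subset A B -> c A <= c B.
Proof. intros [(_ & _ & _ & _ & H & _) _]. apply H. Qed.

Lemma capacity_pts (X : Space) c : poss_capacity X c -> c (pts X) = 1.
Proof. intros [(_ & _ & H & _) _]. exact H. Qed.

Lemma capacity_nbhd (X : Space) c (F : car X -> Prop) a :
  compactum X -> poss_capacity X c -> is_closed X F -> c F < a ->
  exists V K, opn X V /\ is_closed X K /\ subset F V /\ subset V K /\ c K < a.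
Proof.
  intros HX [(_ & _ & _ & _ & _ & H) _] HF Ha.
  destruct (H F a HF Ha) as (O & HO & FO & HOa).
  destruct (normal_shrink X F O HX HF HO FO) as (V & K & HV & HK & FV & VK & KO).
  exists V, K. auto 10.
Qed.

(** The induction carries enclosure in a closed [K] with [c K < a], since [c] is meaningful only on
    closed sets. Unions are handled by the maximum rule, the empty set by [0 < a]. *)
Lemma capacity_lt (X : Space) c (F : car X -> Prop) a :
  compactum X -> poss_capacity X c -> is_closed X F -> 0 < a ->
  (forall x, F x -> c (sing x) < a) -> c F < a.
Proof.
  intros HX Hc HF Ha H. pose proof HX as (HT & HC & _).
  pose proof Hc as [(_ & _ & _ & Hc0 & _) Hun].
  assert (HP : exists K, is_closed X K /\ subset F K /\ c K < a).
  { apply (compact_induct X (fun A => exists K, is_closed X K /\ subset A K /\ c K < a));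
      auto.
    - intros A B AB (K & HK & BK & Hlt). exists K. repeat split; auto; try apply HK.
      intros x Hx; auto.
    - exists (fun _ => False). rewrite Hc0. repeat split; auto; try apply closed_empty; auto.
      intros x; tauto.
    - intros A B (K & HK & AK & Hlt) (L & HL & BL & Hlt').
      exists (fun x => K x \/ L x). split; [apply closed_union; auto |].
      split; [intros x [Hx | Hx]; auto |].
      rewrite Hun; auto. apply Rmax_lub_lt; auto.
    - intros x Fx.
      destruct (capacity_nbhd X c (sing x) a) as (V & K & HV & HK & xV & VK & Hlt); auto.
      { apply closed_sing; auto. apply (proj1 HF); auto. }
      exists V. repeat split; auto.
      + apply xV. reflexivity.
      + exists K. auto. }
  destruct HP as (K & HK & FK & Hlt).
  apply Rle_lt_trans with (c K); auto. apply (capacity_mono X); auto.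
Qed.

(** If every point of [F] had a value below [c F], the strict bound with [a := c F] would give
    [c F < c F]. *)
Lemma capacity_point (X : Space) c (F : car X -> Prop) :
  compactum X -> poss_capacity X c -> is_closed X F -> 0 < c F ->
  exists x, F x /\ c F <= c (sing x).
Proof.
  intros HX Hc HF Ha. apply NNPP. intros H.
  assert (c F < c F); [| lra].
  apply (capacity_lt X); auto.
  intros x Fx. apply Rnot_le_lt. intros Hle. apply H. eauto.
Qed.

Lemma capacity_sing_le (X : Space) c (F : car X -> Prop) x :
  compactum X -> poss_capacity X c -> is_closed X F -> F x -> c (sing x) <= c F.
Proof.
  intros HX Hc HF Fx. apply (capacity_mono X); auto.
  - apply closed_sing; auto. apply (proj1 HF); auto.
  - intros y ->. auto.
Qed.

(** * Upper semicontinuous densities and the capacities they define *)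

Definition usc (X : Space) (d : car X -> R) : Prop :=
  forall x a, pts X x -> d x < a ->
    exists U, opn X U /\ U x /\ forall y, U y -> d y < a.

Lemma usc_max (X : Space) (d : car X -> R) (F : car X -> Prop) :
  compactum X -> usc X d -> is_closed X F -> (exists x, F x) ->
  exists x, F x /\ forall y, F y -> d y <= d x.
Proof.
  intros HX Hd HF [x0 Fx0]. pose proof HX as (HT & HC & _).
  assert (Hb : exists b, forall x, F x -> d x <= b).
  { apply (compact_induct X (fun A => exists b, forall x, A x -> d x <= b)); auto.
    - intros A B AB (b & Hb). exists b. auto.
    - exists 0. tauto.
    - intros A B (b & Hb) (b' & Hb'). exists (Rmax b b').
      intros x [Hx | Hx]; [apply Rle_trans with b | apply Rle_trans with b'];
        auto using Rmax_l, Rmax_r.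
    - intros x Fx. destruct (Hd x (d x + 1)) as (U & HU & Ux & H); [| lra |].
      + apply (proj1 HF); auto.
      + exists U. repeat split; auto. exists (d x + 1).
        intros y Uy. apply Rlt_le; auto. }
  destruct Hb as (b & Hb).
  destruct (completeness (fun r => exists x, F x /\ r = d x)) as (m & Hm1 & Hm2).
  { exists b. intros r (x & Fx & ->). auto. }
  { exists (d x0). eauto. }
  assert (Hm : forall x, F x -> d x <= m) by (intros x Fx; apply Hm1; eauto).
  apply NNPP. intros Hno.
  (* If no point reached the supremum [m], each point would have a neighbourhood bounded by a number
     strictly below [m]. Finite unions preserve this, so [m] would not be least. *)
  assert (H : exists b, b < m /\ forall x, F x -> d x <= b).
  { apply (compact_induct X (fun A => exists b, b < m /\ forall x, A x -> d x <= b)); auto.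
    - intros A B AB (e & He & H). exists e. auto.
    - exists (m - 1). split; [lra | tauto].
    - intros A B (e & He & H) (e' & He' & H'). exists (Rmax e e').
      split; [apply Rmax_lub_lt; auto |].
      intros x [Hx | Hx]; [apply Rle_trans with e | apply Rle_trans with e'];
        auto using Rmax_l, Rmax_r.
    - intros x Fx.
      assert (d x < m).
      { apply Rnot_le_lt. intros Hle. apply Hno. exists x. split; auto.
        intros y Fy. apply Rle_trans with m; auto. }
      destruct (Hd x ((d x + m) / 2)) as (U & HU & Ux & HUd); [| lra |].
      + apply (proj1 HF); auto.
      + exists U. repeat split; auto. exists ((d x + m) / 2). split; [lra |].
        intros y Uy. apply Rlt_le; auto. }
  destruct H as (e & He & H).
  assert (m <= e); [| lra].
  apply Hm2. intros r (x & Fx & ->). auto.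
Qed.

(* The hypotheses say that [c] vanishes off the closed sets and that
   [c A = max {d x : x in A}] for closed [A] (0 when [A] is empty). *)
Lemma poss_capacity_of_density (X : Space) (d : car X -> R) c :
  compactum X -> usc X d ->
  (forall A, ~ is_closed X A -> c A = 0) ->
  (forall A, is_closed X A -> 0 <= c A <= 1) ->
  (forall A, is_closed X A -> 0 < c A -> exists x, A x /\ c A <= d x) ->
  (forall A x, is_closed X A -> A x -> d x <= c A) ->
  (exists x, pts X x /\ 1 <= d x) ->
  poss_capacity X c.
Proof.
  intros HX Hd H0 H01 Hex Hle [x1 [Px1 Hx1]]. pose proof HX as (HT & HC & _).
  assert (Hmono : forall A B, is_closed X A -> is_closed X B -> subset A B -> c A <= c B).
  { intros A B HA HB AB. apply Rnot_lt_le. intros Hlt.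
    destruct (Hex A HA) as (x & Ax & Hx).
    - apply Rle_lt_trans with (c B); auto. apply H01; auto.
    - specialize (Hle B x HB (AB x Ax)). lra. }
  split; [repeat split |].
  - auto.
  - apply H01; auto.
  - apply H01; auto.
  - apply Rle_antisym; [apply H01, closed_pts; auto |].
    apply Rle_trans with (d x1); auto. apply Hle; auto. apply closed_pts; auto.
  - apply Rle_antisym; [| apply H01, closed_empty; auto].
    apply Rnot_lt_le. intros Hlt.
    destruct (Hex _ (closed_empty X HT) Hlt) as (x & [] & _).
  - auto.
  - intros F a HF Ha.
    assert (0 <= c F) by (apply H01; auto).
    (* The sublevel set of [d] works: a positive value [c B] is attained by [d] at a point of [B],
       hence lies below [a]. *)
    exists (fun x => pts X x /\ d x < a). split; [| split].
    + apply open_nbhd; auto. intros x [Px Hx].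
      destruct (Hd x a Px Hx) as (U & HU & Ux & HUa).
      exists U. repeat split; auto. apply (proj1 HT U); auto.
    + intros x Fx. split; [apply (proj1 HF); auto |].
      specialize (Hle F x HF Fx). lra.
    + intros B HB BO. apply Rnot_le_lt. intros Hlt.
      destruct (Hex B HB) as (x & Bx & Hx).
      * apply NNPP. intros Hn. assert (c B = 0) by (specialize (H01 B HB); lra).
        lra.
      * destruct (BO x Bx). lra.
  - intros A B HA HB.
    assert (HAB : is_closed X (fun x => A x \/ B x)) by (apply closed_union; auto).
    apply Rle_antisym.
    + apply Rnot_lt_le. intros Hlt.
      assert (0 <= c A) by (apply H01; auto).
      pose proof (Rmax_l (c A) (c B)). pose proof (Rmax_r (c A) (c B)).
      destruct (Hex _ HAB) as (x & [Hx | Hx] & Hxd); [lra | |];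
        [specialize (Hle A x HA Hx) | specialize (Hle B x HB Hx)]; lra.
    + apply Rmax_lub; apply Hmono; auto; intros x; tauto.
Qed.

Lemma density_capacity (X : Space) (d : car X -> R) :
  compactum X -> usc X d -> (forall x, pts X x -> 0 <= d x <= 1) ->
  (exists x, pts X x /\ 1 <= d x) ->
  exists c, poss_capacity X c /\
    (forall A, is_closed X A -> 0 < c A -> exists x, A x /\ c A <= d x) /\
    (forall A x, is_closed X A -> A x -> d x <= c A).
Proof.
  intros HX Hd H01 Hone.
  (* The second disjunct is the default 0 for the empty set, over which no maximum exists. *)
  set (val := fun A v => (exists x, A x /\ v = d x /\ forall y, A y -> d y <= v) \/
                         ((forall x, ~ A x) /\ v = 0)).
  set (c := fun A => if excluded_middle_informative (is_closed X A)
                     then epsilon (inhabits 0) (val A) else 0).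
  assert (Hc : forall A, is_closed X A -> val A (c A)).
  { intros A HA. unfold c.
    destruct (excluded_middle_informative (is_closed X A)); [| tauto].
    apply epsilon_spec. destruct (classic (exists x, A x)) as [Hx | Hx].
    - destruct (usc_max X d A HX Hd HA Hx) as (x & Ax & Hmax).
      exists (d x). left. eauto.
    - exists 0. right. split; auto. intros x Ax. eauto. }
  assert (Hex : forall A, is_closed X A -> 0 < c A -> exists x, A x /\ c A <= d x).
  { intros A HA Hpos. destruct (Hc A HA) as [(x & Ax & E & _) | [_ E]]; [| lra].
    exists x. split; auto. lra. }
  assert (Hle : forall A x, is_closed X A -> A x -> d x <= c A).
  { intros A x HA Ax. destruct (Hc A HA) as [(y & Ay & E & H) | [H _]]; auto.
    destruct (H x Ax). }
  exists c. split; auto. apply (poss_capacity_of_density X d); auto.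
  - intros A HA. unfold c.
    destruct (excluded_middle_informative (is_closed X A)); tauto.
  - intros A HA. destruct (Hc A HA) as [(y & Ay & E & H) | [_ E]]; rewrite E; [| lra].
    apply H01. apply (proj1 HA); auto.
Qed.

(** * The topology of [M_cup X] *)

(** [generated P S] is the intersection of all topologies on [P] containing [S]. A property of all
    its members is therefore proved by checking that the sets with that property form such a
    topology, without writing open sets as unions of finite intersections. *)
Lemma generated_topology {T : Type} (P : T -> Prop) (S : (T -> Prop) -> Prop) :
  (forall V, S V -> subset V P) -> is_topology P (generated P S).
Proof.
  intros HS. repeat apply conj.
  - intros U HU.
    apply (HU (fun U => subset U P)); auto. repeat split.
    + auto.
    + intros x; tauto.
    + intros x [].
    + intros U' V' HU' HV' x [Hx _]; auto.
    + intros Fam HF x (V & HV & Vx). apply (HF V HV x Vx).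
  - intros op Hop _. apply Hop.
  - intros op (_ & _ & H & _) _. exact H.
  - intros U V HU HV op Hop HSop.
    pose proof Hop as (_ & _ & _ & H & _).
    apply H; [apply HU | apply HV]; auto.
  - intros Fam HF op Hop HSop. pose proof Hop as (_ & _ & _ & _ & H).
    apply H. intros U HU. apply (HF U HU); auto.
Qed.

Lemma generated_sub {T : Type} (P : T -> Prop) (S : (T -> Prop) -> Prop) V :
  S V -> generated P S V.
Proof. intros HV op _ HS. auto. Qed.

Lemma MU_topology (X : Space) : is_topology (pts (MU X)) (opn (MU X)).
Proof.
  apply generated_topology.
  intros V [(F & a & _ & _ & ->) | (U & a & _ & _ & ->)] c [Hc _]; auto.
Qed.

(** The subbase only has [a] in the unit interval; for other [a] the set is empty or the whole
    space. *)
Lemma MU_open_lt (X : Space) (F : car X -> Prop) a :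
  is_closed X F -> opn (MU X) (fun c => poss_capacity X c /\ c F < a).
Proof.
  intros HF. destruct (Rle_or_lt a 1) as [H1 | H1].
  - destruct (Rle_or_lt 0 a) as [H0 | H0].
    + apply generated_sub. left. exists F, a. auto.
    + apply (open_ext (MU X) (fun _ => False)); [| apply open_empty, MU_topology].
      intros c. split; [tauto |]. intros [Hc Ha].
      pose proof (capacity_nonneg X c F Hc). lra.
  - apply (open_ext (MU X) (pts (MU X))); [| apply open_pts, MU_topology].
    intros c. split; [| tauto]. intros Hc. split; auto.
    pose proof (capacity_le_1 X c F Hc). lra.
Qed.

(** A closed [K] inside [U] with [a < c K] has a positive value, so one of its points already has
    value above [a]. This restates the second kind of subbasic set in terms of the density. *)
Lemma MU_open_gt (X : Space) (U : car X -> Prop) a :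
  compactum X -> opn X U -> 0 <= a ->
  opn (MU X) (fun c => poss_capacity X c /\ exists x, U x /\ a < c (sing x)).
Proof.
  intros HX HU H0. pose proof HX as (HT & _).
  destruct (Rle_or_lt a 1) as [H1 | H1].
  - apply generated_sub. right. exists U, a. repeat split; auto.
    apply set_ext. intros c. split.
    + intros (Hc & x & Ux & Hx). split; auto. exists (sing x). repeat split; auto.
      * apply closed_sing; auto. apply (proj1 HT U); auto.
      * apply closed_sing; auto. apply (proj1 HT U); auto.
      * intros y ->. auto.
    + intros (Hc & K & HK & KU & Ha). split; auto.
      destruct (capacity_point X c K HX Hc HK) as (x & Kx & Hx); [lra |].
      exists x. split; auto. lra.
  - apply (open_ext (MU X) (fun _ => False)); [| apply open_empty, MU_topology].
    intros c. split; [tauto |]. intros (Hc & x & _ & Hx).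
    pose proof (capacity_le_1 X c (sing x) Hc). lra.
Qed.

Lemma continuous_MU (Z X : Space) (f : car Z -> car (MU X)) :
  compactum X -> is_topology (pts Z) (opn Z) ->
  (forall z, pts Z z -> poss_capacity X (f z)) ->
  (forall F a, is_closed X F -> 0 <= a ->
     opn Z (fun z => pts Z z /\ f z F < a)) ->
  (forall U a, opn X U -> 0 <= a ->
     opn Z (fun z => pts Z z /\ exists x, U x /\ a < f z (sing x))) ->
  continuous Z (MU X) f.
Proof.
  intros HX HT Hf Hlt Hgt. split; [exact Hf |].
  intros V HV.
  enough (H : subset V (poss_capacity X) /\ opn Z (fun z => pts Z z /\ V (f z))) by apply H.
  apply (HV (fun V => subset V (poss_capacity X) /\ opn Z (fun z => pts Z z /\ V (f z)))).
  - split; [intros U [HU _]; exact HU |]. repeat apply conj.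
    + intros c; auto.
    + apply (open_ext Z (pts Z)); [| apply open_pts; auto].
      intros z. specialize (Hf z). tauto.
    + intros c [].
    + apply (open_ext Z (fun _ => False)); [intros z; tauto | apply open_empty; auto].
    + intros U W [HU HU'] [HW HW']. split; [intros c [Hc _]; auto |].
      apply (open_ext Z (fun z => (pts Z z /\ U (f z)) /\ (pts Z z /\ W (f z))));
        [intros z; tauto | apply open_inter; auto].
    + intros Fam HF. split; [intros c (U & HU & Uc); apply (proj1 (HF U HU)); auto |].
      apply open_nbhd; auto. intros z (Pz & U & HU & Uz).
      exists (fun z => pts Z z /\ U (f z)). repeat split; auto.
      * apply (HF U HU).
      * tauto.
      * destruct H; eauto.
  - intros W [(F & a & HF & Ha & ->) | (U & a & HU & Ha & ->)];
      (split; [intros c [Hc _]; exact Hc |]).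
    + apply (open_ext Z (fun z => pts Z z /\ f z F < a)); [| apply Hlt; tauto].
      intros z. specialize (Hf z). tauto.
    + apply (open_ext Z (fun z => pts Z z /\ exists x, U x /\ a < f z (sing x)));
        [| apply Hgt; tauto].
      intros z. split.
      * intros (Pz & x & Ux & Hx). repeat (split; auto).
        assert (pts X x) by (apply (proj1 (proj1 HX) U); auto).
        exists (sing x). split; [apply closed_sing; auto |]. split; auto.
        intros y ->. auto.
      * intros (Pz & Hz & K & HK & KU & HaK). split; auto.
        destruct (capacity_point X (f z) K) as (x & Kx & Hx); auto; [lra |].
        exists x. split; auto. lra.
Qed.

(** * [M_cup X] is a compactum *)

Lemma MU_hausdorff (X : Space) : compactum X -> hausdorff (MU X).
Proof.
  intros HX.
  assert (H : forall c d F, poss_capacity X c -> poss_capacity X d -> is_closed X F ->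
    c F < d F -> exists U V, opn (MU X) U /\ opn (MU X) V /\ U c /\ V d /\
      (forall z, U z -> V z -> False)).
  (* With [a] midway between the two values, [c] stays below [a] on a closed enclosure [K] of [F],
     while [d] exceeds [a] at a point of [V], which lies in [K]. No capacity does both. *)
  { intros c d F Hc Hd HF Hlt. set (a := (c F + d F) / 2).
    pose proof (capacity_nonneg X c F Hc).
    destruct (capacity_nbhd X c F a) as (V & K & HV & HK & FV & VK & Ha); auto;
      [unfold a; lra |].
    exists (fun c => poss_capacity X c /\ c K < a),
      (fun c => poss_capacity X c /\ exists x, V x /\ a < c (sing x)).
    split; [| split; [| split; [| split]]]; [| | split; auto | |].
    - apply MU_open_lt; auto.
    - apply MU_open_gt; auto. unfold a; lra.
    - split; auto. destruct (capacity_point X d F) as (x & Fx & Hx); auto; [lra |].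
      exists x. split; auto. unfold a; lra.
    - intros z [Hz HzK] (_ & x & Vx & Hx).
      pose proof (capacity_sing_le X z K x HX Hz HK (VK x Vx)). lra. }
  intros c d Hc Hd Hne. simpl in Hc, Hd.
  assert (Hex : exists F, is_closed X F /\ c F <> d F).
  { apply NNPP. intros Hno. apply Hne. apply functional_extensionality. intros A.
    destruct (classic (is_closed X A)) as [HA | HA].
    - apply NNPP. eauto.
    - destruct Hc as [[Hc _] _], Hd as [[Hd _] _]. rewrite Hc, Hd; auto. }
  destruct Hex as (F & HF & HFne).
  destruct (Rtotal_order (c F) (d F)) as [Hlt | [E | Hlt]].
  - apply (H c d F); auto.
  - tauto.
  - destruct (H d c F) as (U & V & HU & HV & Ud & Vc & D); auto.
    exists V, U. repeat split; auto. intros z; eauto.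
Qed.

(* In a maximal family without finite subcover the complement is a prime
   filter; a point avoiding its subbasic members is a limit of that filter. *)
Lemma alexander_subbase (T : Type) (P : T -> Prop) (S : (T -> Prop) -> Prop) :
  (forall V, S V -> subset V P) ->
  (forall G : (T -> Prop) -> Prop, (forall V, G V -> S V) ->
     (forall l, (forall V, In V l -> G V) -> exists x, P x /\ forall V, In V l -> ~ V x) ->
     exists x, P x /\ forall V, G V -> ~ V x) ->
  Defs.compact (mkSpace T P (generated P S)).
Proof.
  intros HSP HS Fam Hopen Hcov. simpl in *.
  apply NNPP. intros Hno.
  (* Joining [Fam] to [A] in this condition makes the union of the empty chain admissible for Zorn's
     lemma. *)
  set (nocov := fun A : (T -> Prop) -> Prop =>
    forall l, (forall V, In V l -> A V \/ Fam V) ->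
      exists x, P x /\ forall V, In V l -> ~ V x).
  destruct (@classical_sets.Zorn_bigcup (T -> Prop) nocov) as (A & HA & Hmax).
  { intros C HC Htot l Hl.
    assert (Hone : (forall V, In V l -> Fam V) \/
      exists B, C B /\ forall V, In V l -> B V \/ Fam V).
    { clear -Hl Htot. induction l as [| V l IH]; [left; intros V [] |].
      destruct IH as [IH | (B & CB & IH)]; [intros W HW; apply Hl; simpl; auto | |].
      - destruct (Hl V (or_introl eq_refl)) as [[B CB BV] | FV].
        + right. exists B. split; auto. intros W [<- | HW]; auto.
        + left. intros W [<- | HW]; auto.
      - right. destruct (Hl V (or_introl eq_refl)) as [[B' CB' BV] | FV].
        + destruct (Htot B B' CB CB') as [HBB | HBB].
          * exists B'. split; auto. intros W [<- | HW]; auto.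
            destruct (IH W HW); auto.
          * exists B. split; auto. intros W [<- | HW]; auto.
        + exists B. split; auto. intros W [<- | HW]; auto. }
    destruct Hone as [Hone | (B & CB & Hone)].
    - apply NNPP. intros Hn. apply Hno. exists l. split; auto.
      intros x Px. apply NNPP. intros Hx. apply Hn. exists x. split; auto.
      intros V HV Vx. eauto.
    - apply (HC B CB l Hone). }
  (* By maximality, adding [V] to [A] creates a finite cover; filtering [V] out of it leaves members
     of [A] or [Fam]. *)
  assert (Hout : forall V, ~ A V -> exists l, (forall W, In W l -> A W \/ Fam W) /\
            forall x, P x -> V x \/ exists W, In W l /\ W x).
  { intros V HV. apply NNPP. intros Hn.
    apply (Hmax (fun W => A W \/ W = V)).
    - split; [intros W; auto |]. intros H. apply HV. apply H. auto.
    - intros l Hl. apply NNPP. intros Hl'. apply Hn.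
      exists (filter (fun W => if excluded_middle_informative (A W \/ Fam W)
                               then true else false) l).
      split.
      + intros W HW. apply filter_In in HW as [_ HW].
        destruct (excluded_middle_informative (A W \/ Fam W)); auto. discriminate.
      + intros x Px. apply NNPP. intros Hx. apply Hl'. exists x. split; auto.
        intros W HW Wx. apply Hx.
        destruct (classic (A W \/ Fam W)) as [H | H].
        * right. exists W. split; auto. apply filter_In. split; auto.
          destruct (excluded_middle_informative (A W \/ Fam W)); tauto.
        * left. destruct (Hl W HW) as [[H' | <-] | H']; tauto. }
  assert (HAF : forall V, Fam V -> A V).
  { intros V FV. apply NNPP. intros AV.
    destruct (Hout V AV) as (l & Hl & Hc).
    destruct (HA (V :: l)) as (x & Px & Hx).
    - intros W [<- | HW]; auto.
    - destruct (Hc x Px) as [Vx | (W & HW & Wx)].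
      + apply (Hx V); simpl; auto.
      + apply (Hx W); simpl; auto. }
  assert (Hfin : forall l, (forall V, In V l -> A V) ->
            exists x, P x /\ forall V, In V l -> ~ V x) by (intros l Hl; apply HA; auto).
  assert (Hout' : forall V, ~ A V -> exists l, (forall W, In W l -> A W) /\
            forall x, P x -> V x \/ exists W, In W l /\ W x).
  { intros V HV. destruct (Hout V HV) as (l & Hl & H). exists l. split; auto.
    intros W HW. destruct (Hl W HW); auto. }
  destruct (HS (fun V => S V /\ A V)) as (p & Pp & Hp).
  { tauto. }
  { intros l Hl. apply Hfin. intros V HV. apply Hl; auto. }
  destruct (Hcov p Pp) as (V & FV & Vp).
  (* No open neighbourhood of [p] lies in [A]: the sets with this property form a topology
     containing the subbase. For an intersection, the two finite covers given by maximality are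
     merged. *)
  enough (H : subset V P /\ (V p -> ~ A V)) by (apply (proj2 H); auto).
  apply (Hopen V FV (fun V => subset V P /\ (V p -> ~ A V))).
  - split; [intros U HU; apply HU |]. repeat apply conj.
    + intros x; auto.
    + intros _ AP. destruct (Hfin (P :: nil)) as (x & Px & Hx).
      * intros W [<- | []]. auto.
      * apply (Hx P); simpl; auto.
    + intros x [].
    + intros [].
    + intros U W [HU HU'] [HW HW']. split; [intros x [Ux _]; auto |].
      intros [Up Wp] AUW.
      destruct (Hout' U (HU' Up)) as (l & Hl & Hlc).
      destruct (Hout' W (HW' Wp)) as (m & Hm & Hmc).
      destruct (Hfin ((fun x => U x /\ W x) :: l ++ m)) as (x & Px & Hx).
      * intros W0 [<- | HW0]; auto. apply in_app_iff in HW0 as [H | H]; auto.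
      * destruct (Hlc x Px) as [Ux | (W0 & HW0 & W0x)].
        -- destruct (Hmc x Px) as [Wx | (W0 & HW0 & W0x)].
           ++ apply (Hx (fun x => U x /\ W x)); simpl; auto.
           ++ apply (Hx W0); simpl; auto. right. apply in_app_iff. auto.
        -- apply (Hx W0); simpl; auto. right. apply in_app_iff. auto.
    + intros Fam' HF. split.
      * intros x (U & HU & Ux). apply (proj1 (HF U HU)); auto.
      * intros (U & HU & Up) Aun. destruct (HF U HU) as [_ HUp].
        destruct (Hout' U (HUp Up)) as (l & Hl & Hlc).
        destruct (Hfin ((fun x => exists U, Fam' U /\ U x) :: l)) as (x & Px & Hx).
        -- intros W0 [<- | HW0]; auto.
        -- destruct (Hlc x Px) as [Ux | (W0 & HW0 & W0x)].
           ++ apply (Hx (fun x => exists U, Fam' U /\ U x)); simpl; eauto.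
           ++ apply (Hx W0); simpl; auto.
  - intros W SW. split; [apply HSP; auto |]. intros Wp AW.
    apply (Hp W); auto.
Qed.

(* A family of subbasic sets is avoided by a capacity iff it is avoided by the
   largest capacity satisfying [c U <= b] for each member [c U > b], which has
   density [d x = inf {b : x in U}]. *)
Lemma MU_compact (X : Space) : compactum X -> Defs.compact (MU X).
Proof.
  intros HX. pose proof HX as (HT & HC & _).
  apply alexander_subbase.
  { intros V [(F & a & _ & _ & ->) | (U & a & _ & _ & ->)] c [Hc _]; auto. }
  intros G HG Hfin.
  set (gt := fun (U : car X -> Prop) b c => poss_capacity X c /\
            exists K, is_closed X K /\ subset K U /\ b < c K).
  set (J := fun U b => opn X U /\ 0 <= b <= 1 /\ G (gt U b)).
  (* [d x] is one minus the supremum of [E x], so that completeness for suprema applies. The element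
     0 makes [d x] equal to 1 when no member of [J] contains [x]. *)
  set (E := fun x s => s = 0 \/ exists U b, J U b /\ U x /\ s = 1 - b).
  assert (HE : forall x, exists d, (forall s, E x s -> d <= 1 - s) /\
            forall a, d < a -> exists s, E x s /\ 1 - s < a).
  { intros x. destruct (completeness (E x)) as (m & Hm1 & Hm2).
    - exists 1. intros s [-> | (U & b & (_ & Hb & _) & _ & ->)]; lra.
    - exists 0. left. reflexivity.
    - exists (1 - m). split.
      + intros s Hs. specialize (Hm1 s Hs). lra.
      + intros a Ha. apply NNPP. intros Hn. assert (m <= 1 - a); [| lra].
        apply Hm2. intros s Hs. apply Rnot_lt_le. intros Hlt. apply Hn.
        exists s. split; auto. lra. }
  set (d := fun x => epsilon (inhabits 0) (fun d => (forall s, E x s -> d <= 1 - s) /\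
            forall a, d < a -> exists s, E x s /\ 1 - s < a)).
  assert (Hd : forall x, (forall s, E x s -> d x <= 1 - s) /\
            forall a, d x < a -> exists s, E x s /\ 1 - s < a).
  { intros x. apply (epsilon_spec (inhabits 0) _ (HE x)). }
  clearbody d. clear HE.
  assert (Hd1 : forall x, d x <= 1).
  { intros x. replace 1 with (1 - 0) by lra. apply (proj1 (Hd x)). left. auto. }
  assert (HdU : forall U b x, J U b -> U x -> d x <= b).
  { intros U b x HJ Ux. replace b with (1 - (1 - b)) by lra. apply (proj1 (Hd x)).
    right. eauto. }
  assert (Hdlt : forall x a, d x < a -> a <= 1 -> exists U b, J U b /\ U x /\ b < a).
  { intros x a Ha Ha1. destruct (proj2 (Hd x) a Ha) as (s & [-> | Hs] & Hlt); [lra |].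
    destruct Hs as (U & b & HJ & Ux & ->). exists U, b. repeat (split; auto). lra. }
  assert (Hd0 : forall x, 0 <= d x).
  { intros x. apply Rnot_lt_le. intros Hlt.
    destruct (Hdlt x 0 Hlt) as (U & b & (_ & Hb & _) & _ & Hb0); lra. }
  assert (Husc : usc X d).
  { intros x a Px Ha. destruct (Rle_or_lt a 1) as [Ha1 | Ha1].
    - destruct (Hdlt x a Ha Ha1) as (U & b & HJ & Ux & Hb).
      exists U. split; [apply HJ |]. split; auto.
      intros y Uy. specialize (HdU U b y HJ Uy). lra.
    - exists (pts X). split; [apply open_pts; auto |]. split; auto.
      intros y _. specialize (Hd1 y). lra. }
  (* Compactness of [F] extracts finitely many members of [G] whose avoidance alone forces
     [c F < a]; only then can the finite hypothesis [Hfin] be applied. *)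
  assert (Hlist : forall F a, is_closed X F -> 0 < a <= 1 -> (forall x, F x -> d x < a) ->
    exists l, (forall V, In V l -> G V) /\
      forall c, poss_capacity X c -> (forall V, In V l -> ~ V c) -> c F < a).
  { intros F a HF Ha HFa.
    assert (H : exists l K, (forall V, In V l -> G V) /\ is_closed X K /\ subset F K /\
      forall c, poss_capacity X c -> (forall V, In V l -> ~ V c) -> c K < a).
    { apply (compact_induct X (fun A => exists l K, (forall V, In V l -> G V) /\
        is_closed X K /\ subset A K /\
        forall c, poss_capacity X c -> (forall V, In V l -> ~ V c) -> c K < a)); auto.
      - intros A B AB (l & K & Hl & HK & BK & H). exists l, K.
        repeat (split; auto). intros x Hx; auto.
      - exists nil, (fun _ => False). split; [intros V [] |].
        split; [apply closed_empty; auto |]. split; [intros x [] |].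
        intros c [(_ & _ & _ & H & _) _] _. rewrite H. lra.
      - intros A B (l & K & Hl & HK & AK & H) (m & L & Hm & HL & BL & H').
        exists (l ++ m), (fun x => K x \/ L x).
        split; [intros V HV; apply in_app_iff in HV as [HV | HV]; auto |].
        split; [apply closed_union; auto |].
        split; [intros x [Hx | Hx]; auto |].
        intros c Hc HV. rewrite (proj2 Hc); auto.
        apply Rmax_lub_lt; [apply H | apply H']; auto;
          intros V HVl; apply HV, in_app_iff; auto.
      - intros x Fx. assert (Px : pts X x) by (apply (proj1 HF); auto).
        destruct (Hdlt x a (HFa x Fx)) as (U & b & HJ & Ux & Hb); [tauto |].
        destruct (normal_shrink X (sing x) U) as (V & K & HV & HK & xV & VK & KU); auto.
        + apply closed_sing; auto.
        + apply HJ.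
        + intros y ->; auto.
        + exists V. split; auto. split; [apply xV; reflexivity |].
          exists (gt U b :: nil), K. split; [intros W [<- | []]; apply HJ |].
          split; auto. split; auto. intros c Hc HW.
          apply Rle_lt_trans with b; auto. apply Rnot_lt_le. intros Hlt.
          apply (HW (gt U b)); [left; auto |]. split; eauto. }
    destruct H as (l & K & Hl & HK & FK & H). exists l. split; auto.
    intros c Hc HV. apply Rle_lt_trans with (c K); auto.
    apply (capacity_mono X); auto. }
  destruct (density_capacity X d) as (c & Hc & Hcx & Hdc); auto.
  (* If [d] stayed below 1, avoiding finitely many members of [G] would force total mass below 1,
     yet [Hfin] gives a capacity avoiding them. *)
  { apply NNPP. intros Hn. destruct (Hlist (pts X) 1) as (l & Hl & H).
    - apply closed_pts; auto.
    - lra.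
    - intros x Px. apply Rnot_le_lt. intros Hle. apply Hn. eauto.
    - destruct (Hfin l Hl) as (c & Hc & HV). specialize (H c Hc HV).
      rewrite (capacity_pts X c Hc) in H. lra. }
  exists c. split; auto. intros V GV Vc.
  destruct (HG V GV) as [(F & a & HF & Ha & ->) | (U & b & HU & Hb & ->)].
  (* If the extremal capacity were below [a] on [F], so would be every capacity avoiding some finite
     list from [G]. Adjoining this member to the list would then contradict [Hfin]. *)
  - destruct Vc as [_ Hlt]. pose proof (capacity_nonneg X c F Hc).
    destruct (Hlist F a) as (l & Hl & H'); auto; [lra | |].
    + intros x Fx. specialize (Hdc F x HF Fx). lra.
    + destruct (Hfin ((fun c => poss_capacity X c /\ c F < a) :: l)) as (e & He & HV).
      * intros W [<- | HW]; auto.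
      * apply (HV (fun c => poss_capacity X c /\ c F < a)); [left; auto |].
        split; auto. apply H'; auto. intros W HW. apply HV. right. auto.
  - destruct Vc as (_ & K & HK & KU & Hlt).
    destruct (Hcx K HK) as (x & Kx & Hx); [lra |].
    assert (d x <= b); [| lra].
    apply (HdU U b); auto. split; auto.
Qed.

Lemma MU_compactum (X : Space) : compactum X -> compactum (MU X).
Proof.
  intros HX. split; [apply MU_topology |].
  split; [apply MU_compact | apply MU_hausdorff]; auto.
Qed.

(** * The unit and the action of [M_cup] on maps *)

Lemma etaR_in (X : Space) x A : is_closed X A -> A x -> etaR X x A = 1.
Proof.
  intros HA Ax. unfold etaR.
  destruct (excluded_middle_informative (is_closed X A /\ A x)); tauto.
Qed.

Lemma etaR_notin (X : Space) x A : ~ A x -> etaR X x A = 0.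
Proof.
  intros Ax. unfold etaR.
  destruct (excluded_middle_informative (is_closed X A /\ A x)); tauto.
Qed.


Lemma MR_closed (X Y : Space) f c B :
  is_closed Y B -> MR X Y f c B = c (fun x => pts X x /\ B (f x)).
Proof.
  intros HB. unfold MR.
  destruct (excluded_middle_informative (is_closed Y B)); tauto.
Qed.

Lemma capacity_usc (X : Space) c :
  compactum X -> poss_capacity X c -> usc X (fun x => c (sing x)).
Proof.
  intros HX Hc x a Px Ha.
  destruct (capacity_nbhd X c (sing x) a) as (V & K & HV & HK & xV & VK & Hlt); auto.
  { apply closed_sing; auto. }
  exists V. split; auto. split; [apply xV; reflexivity |].
  intros y Vy. pose proof (capacity_sing_le X c K y HX Hc HK (VK y Vy)). lra.
Qed.

Lemma etaR_poss (X : Space) x : compactum X -> pts X x -> poss_capacity X (etaR X x).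
Proof.
  intros HX Px. pose proof HX as (HT & _).
  assert (H01 : forall A, 0 <= etaR X x A <= 1).
  { intros A. unfold etaR.
    destruct (excluded_middle_informative (is_closed X A /\ A x)); lra. }
  assert (H1 : etaR X x (sing x) = 1).
  { apply etaR_in; [apply closed_sing; auto | reflexivity]. }
  apply (poss_capacity_of_density X (fun y => etaR X x (sing y))); auto.
  - intros y a Py Ha. destruct (classic (y = x)) as [-> | Hne].
    + exists (pts X). split; [apply open_pts; auto |]. split; auto.
      intros y _. specialize (H01 (sing y)). lra.
    + exists (fun y => pts X y /\ ~ sing x y).
      split; [apply (closed_sing X x HX Px) |]. split; [split; auto |].
      intros z [_ Hz]. rewrite etaR_notin by (intros E; apply Hz; symmetry; exact E).
      specialize (H01 (sing y)). lra.
  - intros A HA. unfold etaR.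
    destruct (excluded_middle_informative (is_closed X A /\ A x)); tauto.
  - intros A HA Hpos. exists x. rewrite H1. split; [| apply H01].
    apply NNPP. intros Ax. rewrite etaR_notin in Hpos; auto. lra.
  - intros A y HA Ay. destruct (classic (x = y)) as [<- | Hne].
    + rewrite (etaR_in X x A); auto. lra.
    + rewrite (etaR_notin X x (sing y)); auto. apply H01.
  - exists x. split; auto. lra.
Qed.

Lemma etaR_continuous (X : Space) : compactum X -> continuous X (MU X) (etaR X).
Proof.
  intros HX. pose proof HX as (HT & _). apply continuous_MU; auto.
  - intros x Px. apply etaR_poss; auto.
  - intros F a HF Ha. apply open_nbhd; auto. intros x [Px Hx].
    destruct (classic (F x)) as [Fx | Fx].
    + rewrite etaR_in in Hx; auto. exists (pts X). split; [apply open_pts; auto |].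
      split; auto. intros y Py. split; auto.
      pose proof (capacity_le_1 X _ F (etaR_poss X y HX Py)). lra.
    + exists (fun x => pts X x /\ ~ F x). split; [apply HF |]. split; auto.
      intros y [Py Fy]. split; auto. rewrite etaR_notin in Hx |- *; auto.
  - intros U a HU Ha. apply open_nbhd; auto. intros x (Px & y & Uy & Hy).
    assert (x = y) as <-.
    { apply NNPP. intros Hne. rewrite etaR_notin in Hy; auto. lra. }
    pose proof (capacity_le_1 X _ (sing x) (etaR_poss X x HX Px)).
    exists U. split; [auto | split; [auto |]]. intros z Uz.
    assert (Pz : pts X z) by (apply (proj1 HT U); auto).
    split; auto. exists z. split; auto.
    rewrite etaR_in; [lra | | reflexivity]. apply closed_sing; auto.
Qed.

Lemma fiber_nbhd (X Y : Space) f y O :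
  compactum X -> compactum Y -> continuous X Y f -> pts Y y -> opn X O ->
  (forall x, pts X x -> f x = y -> O x) ->
  exists W, opn Y W /\ W y /\ forall x, pts X x -> W (f x) -> O x.
Proof.
  intros HX HY [Hf1 Hf2] Py HO Hfib. pose proof HX as (HT & HC & _).
  pose proof HY as (HTY & _ & HH).
  assert (H : exists W, opn Y W /\ W y /\ forall x, pts X x /\ ~ O x -> ~ W (f x)).
  { apply (compact_induct X (fun A => exists W, opn Y W /\ W y /\
      forall x, A x -> ~ W (f x))).
    - exact HC.
    - intros A B AB (W & HW & Wy & H). exists W. auto.
    - exists (pts Y). split; [apply open_pts; auto | tauto].
    - intros A B (W & HW & Wy & H) (W' & HW' & Wy' & H').
      exists (fun y => W y /\ W' y). split; [apply open_inter; auto |].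
      split; auto. intros x [Hx | Hx] [Wx Wx']; [apply (H x) | apply (H' x)]; auto.
    - apply closed_compl; auto.
    - intros x [Px Ox].
      destruct (HH (f x) y) as (U & V & HU & HV & Ufx & Vy & D); auto.
      exists (fun x => pts X x /\ U (f x)). split; [apply Hf2; auto |]. split; auto.
      exists V. split; [auto | split; [auto |]]. intros z [_ Uz] Vz. eauto. }
  destruct H as (W & HW & Wy & H). exists W. split; [auto | split; [auto |]].
  intros x Px Wx. apply NNPP. intros Ox. apply (H x); auto.
Qed.

Lemma MR_poss (X Y : Space) f c :
  compactum X -> compactum Y -> continuous X Y f -> poss_capacity X c ->
  poss_capacity Y (MR X Y f c).
Proof.
  intros HX HY Hf Hc. pose proof HX as (HT & _).
  assert (Hpre : forall B, is_closed Y B -> is_closed X (fun x => pts X x /\ B (f x))).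
  { intros B HB. apply (closed_preimage X Y); auto. }
  apply (poss_capacity_of_density Y (fun y => MR X Y f c (sing y))); auto.
  (* The fibre over [y] is enclosed in a closed [K] of value below [a], and the fibres over points
     near [y] stay inside [K]. *)
  - intros y a Py Ha.
    rewrite MR_closed in Ha by (apply closed_sing; auto).
    destruct (capacity_nbhd X c (fun x => pts X x /\ sing y (f x)) a)
      as (V & K & HV & HK & fV & VK & Hlt); auto.
    { apply Hpre, closed_sing; auto. }
    destruct (fiber_nbhd X Y f y V) as (W & HW & Wy & H); auto.
    exists W. split; [auto | split; [auto |]]. intros z Wz.
    assert (Pz : pts Y z) by (apply (proj1 (proj1 HY) W); auto).
    rewrite MR_closed by (apply closed_sing; auto).
    apply Rle_lt_trans with (c K); auto. apply (capacity_mono X); auto.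
    + apply Hpre, closed_sing; auto.
    + intros x [Px E]. apply VK, H; auto. rewrite E. auto.
  - intros A HA. unfold MR.
    destruct (excluded_middle_informative (is_closed Y A)); tauto.
  - intros A HA. rewrite MR_closed; auto.
    split; [apply (capacity_nonneg X) | apply (capacity_le_1 X)]; auto.
  - intros A HA Hpos. rewrite MR_closed in Hpos |- *; auto.
    destruct (capacity_point X c _ HX Hc (Hpre A HA) Hpos) as (x & [Px Ax] & Hx).
    exists (f x). split; auto. apply Rle_trans with (1 := Hx).
    assert (is_closed Y (sing (f x))) by (apply closed_sing; auto; apply Hf; auto).
    rewrite MR_closed; auto. apply capacity_sing_le; auto. split; auto. reflexivity.
  - intros A y HA Ay.
    assert (is_closed Y (sing y)) by (apply closed_sing; auto; apply (proj1 HA); auto).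
    rewrite !MR_closed; auto. apply (capacity_mono X); auto.
    intros x [Px E]. split; auto. rewrite E. auto.
  - destruct (capacity_point X c (pts X) HX Hc) as (x & Px & Hx).
    + apply closed_pts; auto.
    + rewrite (capacity_pts X c Hc). lra.
    + rewrite (capacity_pts X c Hc) in Hx.
      exists (f x). split; [apply Hf; auto |].
      apply Rle_trans with (1 := Hx).
      assert (is_closed Y (sing (f x))) by (apply closed_sing; auto; apply Hf; auto).
      rewrite MR_closed; auto. apply capacity_sing_le; auto. split; auto. reflexivity.
Qed.

Lemma MR_sing_le (X Y : Space) f c x :
  compactum X -> compactum Y -> continuous X Y f -> poss_capacity X c -> pts X x ->
  c (sing x) <= MR X Y f c (sing (f x)).
Proof.
  intros HX HY Hf Hc Px.
  assert (H : is_closed Y (sing (f x))) by (apply closed_sing; auto; apply Hf; auto).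
  rewrite MR_closed; auto. apply capacity_sing_le; auto.
  - apply (closed_preimage X Y); auto.
  - split; auto. reflexivity.
Qed.

(** With [MR_sing_le], this identifies the density of the image at [y] as the maximum of the density
    of [c] over the fibre. Positivity excludes an empty fibre. *)
Lemma MR_sing_point (X Y : Space) f c y :
  compactum X -> compactum Y -> continuous X Y f -> poss_capacity X c -> pts Y y ->
  0 < MR X Y f c (sing y) ->
  exists x, pts X x /\ f x = y /\ MR X Y f c (sing y) <= c (sing x).
Proof.
  intros HX HY Hf Hc Py Hpos.
  assert (Hy : is_closed Y (sing y)) by (apply closed_sing; auto).
  rewrite MR_closed in Hpos |- *; auto.
  destruct (capacity_point X c _ HX Hc (closed_preimage X Y f _ Hf Hy) Hpos)
    as (x & [Px E] & Hx).
  exists x. auto.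
Qed.

Lemma MR_continuous (X Y : Space) f :
  compactum X -> compactum Y -> continuous X Y f ->
  continuous (MU X) (MU Y) (MR X Y f).
Proof.
  intros HX HY Hf. apply continuous_MU; auto.
  - apply MU_topology.
  - intros c Hc. apply MR_poss; auto.
  - intros F a HF Ha.
    apply (open_ext (MU X) (fun c => poss_capacity X c /\
             c (fun x => pts X x /\ F (f x)) < a)).
    + intros c. rewrite MR_closed; auto. tauto.
    + apply MU_open_lt, (closed_preimage X Y); auto.
  - intros U a HU Ha.
    apply (open_ext (MU X) (fun c => poss_capacity X c /\
             exists x, (pts X x /\ U (f x)) /\ a < c (sing x))).
    + intros c. split.
      * intros (Hc & x & [Px Ux] & Hx). split; auto. exists (f x). split; auto.
        pose proof (MR_sing_le X Y f c x HX HY Hf Hc Px). lra.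
      * intros (Hc & y & Uy & Hy). split; auto.
        destruct (MR_sing_point X Y f c y) as (x & Px & <- & Hx); auto; [| lra |].
        -- apply (proj1 (proj1 HY) U); auto.
        -- exists x. repeat (split; auto). lra.
    + apply MU_open_gt; auto. apply (proj2 Hf); auto.
Qed.

(** * The multiplication: existence of the maximum, values in [M_cup X], continuity *)

(** Strict slack in both factors turns an upper bound on a product into two separate open
    conditions. *)
Lemma Rmult_lt_split (p q a : R) :
  0 <= p -> 0 <= q -> p * q < a -> exists p' q', p < p' /\ q < q' /\ p' * q' <= a.
Proof.
  intros Hp Hq Ha.
  assert (Hs : 0 < p + q + 1) by lra.
  (* Since [e <= 1], the increase of the product is [e (p + q + e)], at most [e (p + q + 1)], hence
     at most [a - p q]. *)
  set (e := Rmin 1 ((a - p * q) / (p + q + 1))).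
  assert (He : 0 < e).
  { apply Rmin_pos; [lra |]. apply Rdiv_lt_0_compat; lra. }
  assert (He1 : e <= 1) by apply Rmin_l.
  assert (He2 : e * (p + q + 1) <= a - p * q).
  { apply Rle_trans with ((a - p * q) / (p + q + 1) * (p + q + 1)).
    - apply Rmult_le_compat_r; [lra | apply Rmin_r].
    - right. field. lra. }
  exists (p + e), (q + e). repeat split; [lra | lra |]. nra.
Qed.

Lemma Rmult_lt_bound (p q p' q' a : R) :
  0 <= p -> 0 <= q -> p < p' -> q < q' -> p' * q' <= a -> p * q < a.
Proof. intros. nra. Qed.

Lemma usc_eval (X : Space) F : is_closed X F -> usc (MU X) (fun c => c F).
Proof.
  intros HF c a Hc Ha. exists (fun c => poss_capacity X c /\ c F < a).
  split; [apply MU_open_lt; auto |]. split; [split; auto |]. tauto.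
Qed.

Lemma usc_mul (X : Space) d e :
  compactum X -> (forall x, pts X x -> 0 <= d x) -> (forall x, pts X x -> 0 <= e x) ->
  usc X d -> usc X e -> usc X (fun x => d x * e x).
Proof.
  intros HX Hd0 He0 Hd He x a Px Ha. pose proof HX as (HT & _).
  destruct (Rmult_lt_split (d x) (e x) a) as (p & q & Hp & Hq & Hpq); auto.
  destruct (Hd x p Px Hp) as (U & HU & Ux & HUp).
  destruct (He x q Px Hq) as (V & HV & Vx & HVq).
  exists (fun x => U x /\ V x). split; [apply open_inter; auto |]. split; auto.
  intros y [Uy Vy]. assert (pts X y) by (apply (proj1 HT U); auto).
  apply (Rmult_lt_bound _ _ p q); auto.
Qed.

Lemma is_mu_value_unique (X : Space) C F v w :
  is_mu_value X C F v -> is_mu_value X C F w -> v = w.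
Proof.
  intros [(t & Ht & ->) Hv] [(s & Hs & ->) Hw].
  apply Rle_antisym; auto.
Qed.

(** If [C] is positive on a level set, its value there is attained at some [c] with [t <= c F], so
    the level product is at most the product at [c]. Conversely, a maximizing [c0] lies in its own
    level set for [t = c0 F]. *)
Lemma mu_value_max (X : Space) C F :
  compactum X -> poss_capacity (MU X) C -> is_closed X F ->
  exists v, is_mu_value X C F v /\
    (forall c, poss_capacity X c -> C (sing c) * c F <= v) /\
    exists c, poss_capacity X c /\ v = C (sing c) * c F.
Proof.
  intros HX HC HF. pose proof (MU_compactum X HX) as HM.
  pose proof (MU_topology X) as HMT.
  destruct (usc_max (MU X) (fun c => C (sing c) * c F) (pts (MU X)))
    as (c0 & Hc0 & Hmax); auto.
  { apply usc_mul; auto.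
    - intros c _. apply (capacity_nonneg (MU X)); auto.
    - intros c Hc. apply (capacity_nonneg X); auto.
    - apply capacity_usc; auto.
    - apply usc_eval; auto. }
  { apply closed_pts; auto. }
  { destruct (capacity_point (MU X) C (pts (MU X))) as (c & Hc & _); eauto.
    - apply closed_pts; auto.
    - rewrite capacity_pts; auto. lra. }
  simpl in Hc0, Hmax.
  assert (Hlev : forall t, 0 < t <= 1 -> is_closed (MU X) (level_set X F t)).
  { intros t Ht. split; [intros c [Hc _]; auto |].
    apply (open_ext (MU X) (fun c => poss_capacity X c /\ c F < t));
      [| apply MU_open_lt; auto].
    intros c. unfold level_set. simpl. split.
    - intros [Hc Hlt]. split; auto. intros [_ Hle]. lra.
    - intros [Hc Hn]. split; auto. apply Rnot_le_lt. tauto. }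
  assert (Hv0 : 0 <= C (sing c0) * c0 F).
  { apply Rmult_le_pos; [apply (capacity_nonneg (MU X)) | apply (capacity_nonneg X)];
      auto. }
  assert (Hle : forall t, 0 < t <= 1 ->
            C (level_set X F t) * t <= C (sing c0) * c0 F).
  { intros t Ht. destruct (Rle_or_lt (C (level_set X F t)) 0) as [Hz | Hpos]; [nra |].
    destruct (capacity_point (MU X) C _ HM HC (Hlev t Ht) Hpos) as (c & [Hc Htc] & Hle).
    apply Rle_trans with (C (sing c) * c F); auto.
    apply Rmult_le_compat; lra. }
  exists (C (sing c0) * c0 F). split; [split; auto | split; eauto].
  (* When the maximum is 0, all level products vanish and [t = 1] serves; otherwise [c0 F] is
     positive and is an admissible [t]. *)
  destruct (Req_dec (C (sing c0) * c0 F) 0) as [Hz | Hnz].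
  - exists 1. assert (H1 : 0 < 1 <= 1) by lra. split; auto.
    apply Rle_antisym; auto. rewrite Hz, Rmult_1_r. apply (capacity_nonneg (MU X)); auto.
  - assert (H1 : 0 < c0 F <= 1).
    { split; [| apply (capacity_le_1 X); auto].
      destruct (capacity_nonneg X c0 F Hc0) as [H | H]; auto.
      rewrite <- H in Hnz. lra. }
    exists (c0 F). split; auto. apply Rle_antisym; auto.
    apply Rmult_le_compat_r; [lra |].
    apply capacity_sing_le; auto. split; auto. lra.
Qed.

Lemma muR_spec (X : Space) C F :
  compactum X -> poss_capacity (MU X) C -> is_closed X F ->
  is_mu_value X C F (muR X C F) /\
  (forall c, poss_capacity X c -> C (sing c) * c F <= muR X C F) /\
  exists c, poss_capacity X c /\ muR X C F = C (sing c) * c F.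
Proof.
  intros HX HC HF.
  destruct (mu_value_max X C F HX HC HF) as (v & Hv & Hle & Hex).
  assert (E : muR X C F = v).
  { unfold muR. destruct (excluded_middle_informative (is_closed X F)); [| tauto].
    apply (is_mu_value_unique X C F); auto. apply epsilon_spec. eauto. }
  rewrite E. auto.
Qed.

Lemma muR_notclosed (X : Space) C F : ~ is_closed X F -> muR X C F = 0.
Proof.
  intros HF. unfold muR.
  destruct (excluded_middle_informative (is_closed X F)); tauto.
Qed.

Lemma muR_poss (X : Space) C :
  compactum X -> poss_capacity (MU X) C -> poss_capacity X (muR X C).
Proof.
  intros HX HC. pose proof (MU_compactum X HX) as HM. pose proof HX as (HT & _).
  pose proof (MU_topology X) as HMT.
  assert (H01 : forall A, is_closed X A -> 0 <= muR X C A <= 1).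
  { intros A HA. destruct (muR_spec X C A HX HC HA) as (_ & _ & c & Hc & ->).
    pose proof (capacity_nonneg (MU X) C (sing c) HC).
    pose proof (capacity_le_1 (MU X) C (sing c) HC).
    pose proof (capacity_nonneg X c A Hc). pose proof (capacity_le_1 X c A Hc). nra. }
  apply (poss_capacity_of_density X (fun x => muR X C (sing x))); auto.
  - intros x a Px Ha.
    (* One neighbourhood of [x] must serve all [c] at once. Induction over the compactum [M_cup X]
       reduces this to [c] near a fixed capacity, where the density of [C] bounds one factor and a
       closed [K] around [x] bounds the other. *)
    assert (HV : exists V, opn X V /\ V x /\ forall c y, poss_capacity X c -> V y ->
              C (sing c) * c (sing y) < a).
    { destruct (muR_spec X C (sing x)) as (_ & Hle & _); auto.
      { apply closed_sing; auto. }
      assert (HV : exists V, opn X V /\ V x /\ forall c y, pts (MU X) c ->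
        poss_capacity X c -> V y -> C (sing c) * c (sing y) < a).
      { apply (compact_induct (MU X) (fun A => exists V, opn X V /\ V x /\
          forall c y, A c -> poss_capacity X c -> V y ->
            C (sing c) * c (sing y) < a)).
        - apply HM.
        - intros A B AB (V & HV & Vx & H). exists V. repeat (split; auto).
        - exists (pts X). split; [apply open_pts; auto |]. split; auto. tauto.
        - intros A B (V & HV & Vx & H) (V' & HV' & Vx' & H').
          exists (fun x => V x /\ V' x). split; [apply open_inter; auto |].
          split; auto. intros c y [Hc | Hc] Hc' [Vy Vy']; auto.
        - apply closed_pts; auto.
        - intros c Hc. simpl in Hc.
          destruct (Rmult_lt_split (C (sing c)) (c (sing x)) a)
            as (p & q & Hp & Hq & Hpq).
          { apply (capacity_nonneg (MU X)); auto. }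
          { apply (capacity_nonneg X); auto. }
          { apply Rle_lt_trans with (2 := Ha). auto. }
          destruct (capacity_usc (MU X) C HM HC c p Hc Hp) as (U & HU & Uc & HUp).
          destruct (capacity_nbhd X c (sing x) q)
            as (V & K & HV & HK & xV & VK & Hlt); auto.
          { apply closed_sing; auto. }
          exists (fun c => U c /\ (poss_capacity X c /\ c K < q)).
          split; [apply open_inter; auto; apply MU_open_lt; auto |].
          split; auto. exists V. split; auto. split; [apply xV; reflexivity |].
          intros e y (Ue & _ & HeK) He Vy.
          pose proof (capacity_sing_le X e K y HX He HK (VK y Vy)).
          apply (Rmult_lt_bound _ _ p q); auto; [| | lra].
          + apply (capacity_nonneg (MU X)); auto.
          + apply (capacity_nonneg X); auto. }
      destruct HV as (V & HV & Vx & H). exists V. repeat (split; auto). }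
    destruct HV as (V & HV & Vx & H). exists V. split; [auto | split; [auto |]].
    intros y Vy. assert (Py : pts X y) by (apply (proj1 HT V); auto).
    destruct (muR_spec X C (sing y)) as (_ & _ & c & Hc & ->); auto.
    apply closed_sing; auto.
  - intros A. apply muR_notclosed.
  - intros A HA Hpos.
    destruct (muR_spec X C A HX HC HA) as (_ & _ & c & Hc & E).
    rewrite E in Hpos |- *.
    pose proof (capacity_nonneg (MU X) C (sing c) HC) as H0.
    assert (HcA : 0 < c A).
    { destruct (capacity_nonneg X c A Hc) as [H | H]; auto. rewrite <- H in Hpos. lra. }
    destruct (capacity_point X c A HX Hc HA HcA) as (x & Ax & Hx).
    exists x. split; auto.
    destruct (muR_spec X C (sing x)) as (_ & Hle & _); auto.
    { apply closed_sing; auto. apply (proj1 HA); auto. }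
    apply Rle_trans with (2 := Hle c Hc). apply Rmult_le_compat_l; auto.
  - intros A x HA Ax.
    destruct (muR_spec X C A HX HC HA) as (_ & Hle & _).
    destruct (muR_spec X C (sing x)) as (_ & _ & c & Hc & E); auto.
    { apply closed_sing; auto. apply (proj1 HA); auto. }
    rewrite E. apply Rle_trans with (2 := Hle c Hc).
    apply Rmult_le_compat_l; [apply (capacity_nonneg (MU X)); auto |].
    apply capacity_sing_le; auto.
  (* Total mass 1 is attained twice: by [C] at some [c], then by this [c] at some [x]. *)
  - destruct (capacity_point (MU X) C (pts (MU X))) as (c & Hc & HCc); auto.
    { apply closed_pts; auto. }
    { rewrite capacity_pts; auto. lra. }
    rewrite capacity_pts in HCc; auto. simpl in Hc.
    destruct (capacity_point X c (pts X)) as (x & Px & Hx); auto.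
    { apply closed_pts; auto. }
    { rewrite capacity_pts; auto. lra. }
    rewrite capacity_pts in Hx; auto.
    exists x. split; auto.
    destruct (muR_spec X C (sing x)) as (_ & Hle & _); auto.
    { apply closed_sing; auto. }
    apply Rle_trans with (2 := Hle c Hc).
    replace 1 with (1 * 1) by lra. apply Rmult_le_compat; auto; lra.
Qed.

Lemma muR_continuous (X : Space) :
  compactum X -> continuous (MU (MU X)) (MU X) (muR X).
Proof.
  intros HX. pose proof (MU_compactum X HX) as HM. pose proof HX as (HT & _).
  pose proof (MU_topology X) as HMT. pose proof (MU_topology (MU X)) as HMMT.
  apply continuous_MU; auto.
  - intros C HC. apply muR_poss; auto.
  - intros F a HF Ha. apply open_nbhd; auto. intros C [HC Hlt]. simpl in HC.
    (* The bound is again made uniform in [c], now for all [D] near [C]: the condition [D K < p]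
       bounds the weight under [D] of every capacity in [V]. *)
    assert (HW : exists W, opn (MU (MU X)) W /\ W C /\ forall D c, W D ->
              poss_capacity (MU X) D -> pts (MU X) c -> poss_capacity X c ->
              D (sing c) * c F < a).
    { destruct (muR_spec X C F HX HC HF) as (_ & Hle & _).
      apply (compact_induct (MU X) (fun A => exists W, opn (MU (MU X)) W /\ W C /\
        forall D c, W D -> poss_capacity (MU X) D -> A c -> poss_capacity X c ->
              D (sing c) * c F < a)).
      - apply HM.
      - intros A B AB (W & HW & WC & H). exists W. repeat (split; auto).
      - exists (pts (MU (MU X))). split; [apply open_pts; auto |]. split; auto. tauto.
      - intros A B (W & HW & WC & H) (W' & HW' & WC' & H').
        exists (fun x => W x /\ W' x). split; [apply open_inter; auto |].
        split; auto. intros D c [WD WD'] HD [Hc | Hc] Hc'; auto.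
      - apply closed_pts; auto.
      - intros c Hc. simpl in Hc.
        destruct (Rmult_lt_split (C (sing c)) (c F) a) as (p & q & Hp & Hq & Hpq).
        { apply (capacity_nonneg (MU X)); auto. }
        { apply (capacity_nonneg X); auto. }
        { apply Rle_lt_trans with (2 := Hlt). auto. }
        destruct (capacity_nbhd (MU X) C (sing c) p)
          as (V & K & HV & HK & cV & VK & HCK); auto.
        { apply closed_sing; auto. }
        exists (fun e => V e /\ (poss_capacity X e /\ e F < q)).
        split; [apply open_inter; auto; apply MU_open_lt; auto |].
        split; [split; auto; apply cV; reflexivity |].
        exists (fun D => poss_capacity (MU X) D /\ D K < p).
        split; [apply MU_open_lt; auto |]. split; auto.
        intros D e [_ HDK] HD (Ve & _ & HeF) He.
        pose proof (capacity_sing_le (MU X) D K e HM HD HK (VK e Ve)).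
        apply (Rmult_lt_bound _ _ p q); auto; [| | lra].
        + apply (capacity_nonneg (MU X)); auto.
        + apply (capacity_nonneg X); auto. }
    destruct HW as (W & HW & WC & H). exists W. split; [auto | split; [auto |]].
    intros D WD. assert (HD : poss_capacity (MU X) D) by (apply (proj1 HMMT W HW); auto).
    split; auto. destruct (muR_spec X D F HX HD HF) as (_ & _ & c & Hc & ->). auto.
  - intros U a HU Ha. apply open_nbhd; auto. intros C (HC & x & Ux & Hx). simpl in HC.
    assert (Hx' : forall y, U y -> is_closed X (sing y)).
    { intros y Uy. apply closed_sing; auto. apply (proj1 HT U); auto. }
    destruct (muR_spec X C (sing x) HX HC (Hx' x Ux)) as (_ & _ & c & Hc & E).
    rewrite E in Hx.
    pose proof (capacity_nonneg (MU X) C (sing c) HC) as HCc.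
    pose proof (capacity_nonneg X c (sing x) Hc) as Hcx.
    assert (HCpos : 0 < C (sing c)).
    { destruct HCc as [H | H]; auto. rewrite <- H in Hx. lra. }
    (* The choice of [t] strictly between [a / C {c}] and [c {x}] gives both [t < c {x}] and
       [a / t < C {c}]. These are two open conditions whose bounds multiply to [a]. *)
    set (t := (a / C (sing c) + c (sing x)) / 2).
    assert (Hac : a / C (sing c) < c (sing x)).
    { apply Rmult_lt_reg_r with (C (sing c)); auto.
      replace (a / C (sing c) * C (sing c)) with a by (field; lra). lra. }
    assert (Ha0 : 0 <= a / C (sing c)) by (apply Rle_mult_inv_pos; auto).
    assert (Ht0 : 0 < t) by (unfold t; lra).
    assert (Hat : a / t < C (sing c)).
    { apply Rmult_lt_reg_r with t; auto.
      replace (a / t * t) with (a / C (sing c) * C (sing c)) by (field; lra).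
      rewrite Rmult_comm. apply Rmult_lt_compat_l; auto. unfold t; lra. }
    set (W := fun c => poss_capacity X c /\ exists x, U x /\ t < c (sing x)).
    exists (fun D => poss_capacity (MU X) D /\ exists c, W c /\ a / t < D (sing c)).
    split; [| split].
    + apply MU_open_gt; auto.
      * apply MU_open_gt; auto. lra.
      * apply Rle_mult_inv_pos; auto.
    + split; auto. exists c. split; auto. split; auto. exists x. split; auto.
      unfold t; lra.
    + intros D (HD & e & (He & y & Uy & Hy) & HDe). split; auto. exists y. split; auto.
      destruct (muR_spec X D (sing y) HX HD (Hx' y Uy)) as (_ & Hle & _).
      apply Rlt_le_trans with (2 := Hle e He).
      replace a with (a / t * t) by (field; lra).
      assert (0 <= a / t) by (apply Rle_mult_inv_pos; auto).
      apply Rle_lt_trans with (a / t * e (sing y)).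
      * apply Rmult_le_compat_l; lra.
      * apply Rmult_lt_compat_r; lra.
Qed.

(** * The monad identities and naturality *)

Lemma capacity_ext (X : Space) c d :
  poss_capacity X c -> poss_capacity X d ->
  (forall F, is_closed X F -> c F = d F) -> c = d.
Proof.
  intros [[Hc _] _] [[Hd _] _] H. apply functional_extensionality. intros A.
  destruct (classic (is_closed X A)) as [HA | HA]; auto. rewrite Hc, Hd; auto.
Qed.

(** The density of the Dirac capacity at [c] is 1 at [c] and 0 elsewhere, so only the term of [c]
    survives in the maximum. *)
Lemma muR_etaR (X : Space) c :
  compactum X -> poss_capacity X c -> muR X (etaR (MU X) c) = c.
Proof.
  intros HX Hc. pose proof (MU_compactum X HX) as HM.
  assert (HE : poss_capacity (MU X) (etaR (MU X) c)) by (apply etaR_poss; auto).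
  apply (capacity_ext X); auto; [apply muR_poss; auto |].
  intros F HF. destruct (muR_spec X _ F HX HE HF) as (_ & Hle & d & Hd & E).
  assert (H1 : etaR (MU X) c (sing c) = 1).
  { apply etaR_in; [apply closed_sing; auto | reflexivity]. }
  apply Rle_antisym.
  - rewrite E. destruct (classic (c = d)) as [<- | Hne].
    + rewrite H1. lra.
    + rewrite etaR_notin; auto. rewrite Rmult_0_l. apply (capacity_nonneg X); auto.
  - specialize (Hle c Hc). rewrite H1 in Hle. lra.
Qed.

(** Only capacities [etaR X x] carry positive weight, and the factor [etaR X x F] is 1 or 0
    according to whether [x] lies in [F]. What remains is the maximum of the density of [c] over
    [F]. *)
Lemma muR_MR_etaR (X : Space) c :
  compactum X -> poss_capacity X c -> muR X (MR X (MU X) (etaR X) c) = c.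
Proof.
  intros HX Hc. pose proof (MU_compactum X HX) as HM.
  pose proof (etaR_continuous X HX) as Heta.
  assert (HE : poss_capacity (MU X) (MR X (MU X) (etaR X) c)) by (apply MR_poss; auto).
  apply (capacity_ext X); auto; [apply muR_poss; auto |].
  intros F HF. destruct (muR_spec X _ F HX HE HF) as (_ & Hle & d & Hd & E).
  apply Rle_antisym.
  - rewrite E. pose proof (capacity_nonneg X c F Hc).
    destruct (capacity_nonneg (MU X) _ (sing d) HE) as [Hpos | Hz].
    + destruct (MR_sing_point X (MU X) (etaR X) c d) as (x & Px & <- & Hx); auto.
      destruct (classic (F x)) as [Fx | Fx].
      * rewrite (etaR_in X x F), Rmult_1_r; auto. apply Rle_trans with (1 := Hx).
        apply capacity_sing_le; auto.
      * rewrite (etaR_notin X x F), Rmult_0_r; auto.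
    + rewrite <- Hz, Rmult_0_l. auto.
  - destruct (capacity_nonneg X c F Hc) as [Hpos | Hz].
    + destruct (capacity_point X c F HX Hc HF Hpos) as (x & Fx & Hx).
      assert (Px : pts X x) by (apply (proj1 HF); auto).
      specialize (Hle (etaR X x) (etaR_poss X x HX Px)).
      rewrite (etaR_in X x F), Rmult_1_r in Hle; auto.
      apply Rle_trans with (2 := Hle). apply Rle_trans with (1 := Hx).
      apply MR_sing_le; auto.
    + rewrite <- Hz. apply (capacity_nonneg X). apply muR_poss; auto.
Qed.

(* Both sides equal [max {C {D} * D {c} * c F : D, c}]. *)
Lemma muR_assoc (X : Space) C :
  compactum X -> poss_capacity (MU (MU X)) C ->
  muR X (muR (MU X) C) = muR X (MR (MU (MU X)) (MU X) (muR X) C).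
Proof.
  intros HX HC. pose proof (MU_compactum X HX) as HM.
  pose proof (MU_compactum (MU X) HM) as HMM.
  pose proof (muR_continuous X HX) as Hmu.
  assert (HL : poss_capacity (MU X) (muR (MU X) C)) by (apply muR_poss; auto).
  assert (HR : poss_capacity (MU X) (MR (MU (MU X)) (MU X) (muR X) C))
    by (apply MR_poss; auto).
  apply (capacity_ext X); try (apply muR_poss; auto).
  intros F HF.
  destruct (muR_spec X _ F HX HL HF) as (_ & HleL & c & Hc & EL).
  destruct (muR_spec X _ F HX HR HF) as (_ & HleR & d & Hd & ER).
  apply Rle_antisym.
  - rewrite EL.
    destruct (muR_spec (MU X) C (sing c) HM HC) as (_ & _ & D & HD & E).
    { apply closed_sing; auto. }
    rewrite E, Rmult_assoc.
    (* The term of [c] and [D] is dominated by the right-hand term at [muR X D], since [D] lies in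
       the fibre of [muR X] over that capacity. *)
    apply Rle_trans with (2 := HleR (muR X D) (muR_poss X D HX HD)).
    apply Rmult_le_compat.
    + apply (capacity_nonneg (MU (MU X))); auto.
    + apply Rmult_le_pos; [apply (capacity_nonneg (MU X)) | apply (capacity_nonneg X)];
        auto.
    + apply (MR_sing_le (MU (MU X)) (MU X) (muR X) C D); auto.
    + destruct (muR_spec X D F HX HD HF) as (_ & Hle & _). auto.
  - rewrite ER. destruct (capacity_nonneg (MU X) _ (sing d) HR) as [Hpos | Hz].
    (* Positive weight makes [d] equal to [muR X D] for some [D] of at least that weight under [C].
       A maximizing [e] for [muR X D F] then gives a dominating term on the left. *)
    + destruct (MR_sing_point (MU (MU X)) (MU X) (muR X) C d) as (D & HD & <- & HDle);
        auto. simpl in HD.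
      destruct (muR_spec X D F HX HD HF) as (_ & _ & e & He & E).
      apply Rle_trans with (2 := HleL e He).
      apply Rle_trans with (C (sing D) * muR X D F).
      { apply Rmult_le_compat_r; auto. apply (capacity_nonneg X); auto. }
      rewrite E, <- Rmult_assoc. apply Rmult_le_compat_r.
      { apply (capacity_nonneg X); auto. }
      destruct (muR_spec (MU X) C (sing e) HM HC) as (_ & Hle & _); auto.
      apply closed_sing; auto.
    + rewrite <- Hz, Rmult_0_l. apply (capacity_nonneg X). apply muR_poss; auto.
Qed.

Lemma etaR_natural (X Y : Space) f x :
  compactum X -> compactum Y -> continuous X Y f -> pts X x ->
  MR X Y f (etaR X x) = etaR Y (f x).
Proof.
  intros HX HY Hf Px.
  assert (Py : pts Y (f x)) by (apply Hf; auto).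
  apply (capacity_ext Y).
  - apply MR_poss; auto. apply etaR_poss; auto.
  - apply etaR_poss; auto.
  - intros F HF. rewrite MR_closed; auto.
    destruct (classic (F (f x))) as [Fx | Fx].
    + rewrite !etaR_in; auto. apply (closed_preimage X Y); auto.
    + rewrite !etaR_notin; tauto.
Qed.

(** Both sides are the maximum over [c] of [C {c}] times the value of [c] on the preimage of [F].
    Pushing [C] forward along [MR X Y f] groups these terms by image, and the second factor is
    constant on each group. *)
Lemma muR_natural (X Y : Space) f C :
  compactum X -> compactum Y -> continuous X Y f -> poss_capacity (MU X) C ->
  MR X Y f (muR X C) = muR Y (MR (MU X) (MU Y) (MR X Y f) C).
Proof.
  intros HX HY Hf HC.
  pose proof (MU_compactum X HX) as HMX. pose proof (MU_compactum Y HY) as HMY.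
  pose proof (MR_continuous X Y f HX HY Hf) as HMf.
  assert (HL : poss_capacity X (muR X C)) by (apply muR_poss; auto).
  assert (HR : poss_capacity (MU Y) (MR (MU X) (MU Y) (MR X Y f) C))
    by (apply MR_poss; auto).
  apply (capacity_ext Y); [apply MR_poss; auto | apply muR_poss; auto |].
  intros F HF. rewrite MR_closed; auto.
  assert (HfF : is_closed X (fun x => pts X x /\ F (f x)))
    by (apply (closed_preimage X Y); auto).
  destruct (muR_spec X C _ HX HC HfF) as (_ & HleL & c & Hc & EL).
  destruct (muR_spec Y _ F HY HR HF) as (_ & HleR & d & Hd & ER).
  apply Rle_antisym.
  - rewrite EL.
    apply Rle_trans with (2 := HleR (MR X Y f c) (MR_poss X Y f c HX HY Hf Hc)).
    rewrite (MR_closed X Y f c F HF). apply Rmult_le_compat_r.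
    + apply (capacity_nonneg X); auto.
    + apply (MR_sing_le (MU X) (MU Y) (MR X Y f) C c); auto.
  - rewrite ER. destruct (capacity_nonneg (MU Y) _ (sing d) HR) as [Hpos | Hz].
    + destruct (MR_sing_point (MU X) (MU Y) (MR X Y f) C d) as (e & He & <- & Hle); auto.
      apply Rle_trans with (2 := HleL e He).
      rewrite (MR_closed X Y f e F HF). apply Rmult_le_compat_r; auto.
      apply (capacity_nonneg X); auto.
    + rewrite <- Hz, Rmult_0_l. apply (capacity_nonneg X); auto.
Qed.

Theorem theorem1 :
  (forall X : Space, compactum X ->
     (* eta X : X -> M_cup X is a continuous map *)
     continuous X (MU X) (etaR X) /\
     (* mu^bullet X is well defined (the maximum exists) *)
     (forall C, pts (MU (MU X)) C -> forall F, is_closed X F ->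
        exists v, is_mu_value X C F v) /\
     (* mu^bullet X : M_cup^2 X -> M_cup X is a continuous map *)
     continuous (MU (MU X)) (MU X) (muR X) /\
     (* (i) unit laws *)
     (forall c, pts (MU X) c ->
        muR X (etaR (MU X) c) = c /\ muR X (MR X (MU X) (etaR X) c) = c) /\
     (* (ii) associativity *)
     (forall C, pts (MU (MU (MU X))) C ->
        muR X (muR (MU X) C) = muR X (MR (MU (MU X)) (MU X) (muR X) C))) /\
  (* naturality of eta and mu^bullet *)
  (forall (X Y : Space) (f : car X -> car Y),
     compactum X -> compactum Y -> continuous X Y f ->
     (forall x, pts X x -> MR X Y f (etaR X x) = etaR Y (f x)) /\
     (forall C, pts (MU (MU X)) C ->
        MR X Y f (muR X C) = muR Y (MR (MU X) (MU Y) (MR X Y f) C))).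
Proof.
  split.
  - intros X HX. split; [apply etaR_continuous; auto |].
    split; [intros C HC F HF; exists (muR X C F); apply (muR_spec X C F HX HC HF) |].
    split; [apply muR_continuous; auto |].
    split; [intros c Hc; split; [apply muR_etaR | apply muR_MR_etaR]; auto |].
    intros C HC. apply muR_assoc; auto.
  - intros X Y f HX HY Hf.
    split; [intros x Px; apply etaR_natural | intros C HC; apply muR_natural]; auto.
Qed.
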